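(* For any $N_H\in\mathbb{N}$, consider the distribution function $f_{N_H}$ given by the truncated series $$f_{N_H}(t,x,v)=\sum_{n=0}^{N_H-1}C_n(t,x)\Psi_n(t,v),$$ where $(C_n,E_{N_H})$ is a solution of the Hermite weak formulation of the Vlasov-Poisson system given in the context. Then mass, momentum and total energy are conserved, that is, $$\frac{d}{dt}\int_0^L\frac{C_k}{\alpha^k}\,dx=0,\qquad k=0,1,$$ and, for the total energy, $$\mathcal{E}_{N_H}(t):=\frac12\int_0^L\left(\frac{1}{\alpha^2}\left(\sqrt2\,C_2+C_0\right)+|E_{N_H}|^2\right)dx=\mathcal{E}_{N_H}(0).$$
   Context: Let $L>0$, $\alpha_0>0$, $\gamma>0$. Functions of $x\in(0,L)$ are real-valued with periodic boundary conditions; $V$ is the space of $L$-periodic functions in $H^1(0,L)$. The constant $\rho_0$ ensures quasi-neutrality: $\int_0^L(C_0-\rho_0)\,dx=0$. Hermite polynomials: $H_{-1}=0$, $H_0=1$, $\sqrt n\,H_n(\xi)=\xi H_{n-1}(\xi)-\sqrt{n-1}\,H_{n-2}(\xi)$ for $n\ge1$. Basis functions: $\Psi_n(t,v)=\alpha(t)\,H_n(\alpha(t)v)\,\frac{e^{-(\alpha(t)v)^2/2}}{\sqrt{2\pi}}$, where $$\alpha(t)=\alpha_0\left(1+\gamma\int_0^t\|E_{N_H}(s)\|_\infty^2\,ds\right)^{-1/2},$$ and $\|\cdot\|_\infty$ is the sup norm in $x$; $\alpha'$ denotes the time derivative of $\alpha$. Weak formulation: $C_n(t,\cdot)\in V$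 with $\partial_tC_n(t,\cdot)\in V$ ($0\le n\le N_H-1$), $\Phi_{N_H}(t,\cdot)\in V$, $E_{N_H}(t,\cdot)\in V$ with $\partial_tE_{N_H}(t,\cdot)\in V$, and the convention $C_n=0$ for $n<0$ and for $n\ge N_H$. For all $\varphi_n\in V$ and $0\le n\le N_H-1$, $$\frac{d}{dt}\int_0^LC_n\varphi_n\,dx-\frac{\alpha'}{\alpha}\int_0^L\left(nC_n+\sqrt{(n-1)n}\,C_{n-2}\right)\varphi_n\,dx-\frac1\alpha\int_0^L\left(\sqrt n\,C_{n-1}+\sqrt{n+1}\,C_{n+1}\right)\varphi_n'\,dx-\alpha\sqrt n\int_0^LE_{N_H}C_{n-1}\varphi_n\,dx=0,$$ and for all $\eta,\zeta\in V$, $$\int_0^L\Phi_{N_H}\,\eta'\,dx=\int_0^LE_{N_H}\,\eta\,dx,\qquad-\int_0^LE_{N_H}\,\zeta'\,dx=\int_0^L(C_0-\rho_0)\,\zeta\,dx.$$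
   Formalization: Conservation of total energy is stated only for N_H other than 1 and 2, since it fails there (the equation for C_2 is absent; e.g. N_H=1, L=2π, ρ_0=1, C_0=1+cos x, E=sin x); mass and momentum are stated for every N_H. *)

(* Defs.v *)
From mathcomp Require Import all_boot all_order all_algebra.
From mathcomp Require Import all_classical all_reals all_analysis.

Set Implicit Arguments.
Unset Strict Implicit.
Unset Printing Implicit Defensive.

Import Order.TTheory GRing.Theory Num.Theory.
Import numFieldNormedType.Exports.

Local Open Scope classical_set_scope.
Local Open Scope ring_scope.

Definition L2 (R : realType) (L : R) (u : R -> R) : Prop :=
  measurable_fun `[0, L] u /\
  (@lebesgue_measure R).-integrable `[0, L] (fun x => (u x ^+ 2)%:E).

(* C^1 functions with compact support in the open interval (0, L) *)
Definition test_function (R : realType) (L : R) (phi : R -> R) : Prop :=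
  [/\ forall x, derivable phi x 1,
      continuous (derive1 phi) &
      exists a b, [/\ 0 < a, b < L & forall x, x \notin `[a, b] -> phi x = 0]].

(* [du] is an L^2 weak derivative of [u] on (0, L). It is unique only up to
   almost everywhere equality, hence a relation rather than a function. *)
Definition weak_derivative (R : realType) (L : R) (u du : R -> R) : Prop :=
  L2 L du /\
  forall phi, test_function L phi ->
    \int[lebesgue_measure]_(x in `[0, L]) (u x * derive1 phi x) =
    - (\int[lebesgue_measure]_(x in `[0, L]) (du x * phi x)).

Definition H1 (R : realType) (L : R) (u : R -> R) : Prop :=
  L2 L u /\ exists du, weak_derivative L u du.

(* L-periodic functions in H^1(0, L), every class being represented by its
   continuous L-periodic representative on the line; this is what gives a
   meaning to periodicity and to the sup norm. *)
Definition inV (R : realType) (L : R) (u : R -> R) : Prop :=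
  [/\ forall x, u (x + L) = u x, continuous u & H1 L u].

(* The time derivative at [t] of s |-> u s is [du]: the difference quotients
   converge in L^2(0, L). For the curves below, [du] is moreover in V. *)
Definition time_derivative (R : realType) (L : R) (u : R -> R -> R) (t : R)
    (du : R -> R) : Prop :=
  (\int[lebesgue_measure]_(x in `[0, L])
     (((u (t + h) x - u t x) / h - du x) ^+ 2)) @[h --> 0^'] --> (0 : R).

Definition time_right_continuous0 (R : realType) (L : R) (u : R -> R -> R) :
    Prop :=
  (\int[lebesgue_measure]_(x in `[0, L]) ((u h x - u 0 x) ^+ 2)) @[h --> 0^'+]
    --> (0 : R).

Definition supnorm (R : realType) (L : R) (u : R -> R) : R :=
  sup [set `|u x| | x in `[0, L]].

Definition alpha (R : realType) (L alpha0 gamma : R) (E : R -> R -> R)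
    (t : R) : R :=
  alpha0 *
  (1 + gamma *
       (\int[lebesgue_measure]_(s in `[0, t]) (supnorm L (E s) ^+ 2)))
    `^ (- 2^-1).

Fixpoint hermite (R : realType) (n : nat) (xi : R) : R :=
  match n with
  | 0 => 1
  | m.+1 => (xi * hermite m xi -
             match m with
             | 0 => 0
             | p.+1 => Num.sqrt m%:R * hermite p xi
             end) / Num.sqrt m.+1%:R
  end.

(* [a] is the value of alpha at the current time *)
Definition Psi (R : realType) (n : nat) (a v : R) : R :=
  a * hermite n (a * v) * (expR (- (a * v) ^+ 2 / 2) / Num.sqrt (2 * pi)).

Definition truncated_series (R : realType) (L alpha0 gamma : R) (NH : nat)
    (C : int -> R -> R -> R) (E : R -> R -> R) (t x v : R) : R :=
  \sum_(n < NH) C n%:Z t x * Psi n (alpha L alpha0 gamma E t) v.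

(* Solutions on the time interval [0, T), where [T] may be +oo. The equation
   containing d/dt is imposed on (0, T); the initial time is reached by
   continuity in L^2. [C n t x] is indexed by all integers [n]. *)
Record hermite_solution (R : realType) (L alpha0 gamma rho0 : R) (NH : nat)
    (T : \bar R) (C : int -> R -> R -> R) (Phi E : R -> R -> R) : Prop := {
  C_truncation : forall (n : int) (t x : R),
    (n < 0) || (NH%:Z <= n) -> C n t x = 0;
  C_inV : forall (n : nat) (t : R), (n < NH)%N -> 0 <= t -> (t%:E < T)%E ->
    inV L (C n%:Z t);
  C_dt : forall (n : nat) (t : R), (n < NH)%N -> 0 < t -> (t%:E < T)%E ->
    exists2 dC, inV L dC & time_derivative L (C n%:Z) t dC;
  C_init : forall n : nat, (n < NH)%N -> time_right_continuous0 L (C n%:Z);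
  Phi_inV : forall t : R, 0 <= t -> (t%:E < T)%E -> inV L (Phi t);
  E_inV : forall t : R, 0 <= t -> (t%:E < T)%E -> inV L (E t);
  E_dt : forall t : R, 0 < t -> (t%:E < T)%E ->
    exists2 dE, inV L dE & time_derivative L E t dE;
  E_init : time_right_continuous0 L E;
  quasi_neutrality : forall t : R, 0 <= t -> (t%:E < T)%E ->
    \int[lebesgue_measure]_(x in `[0, L]) (C 0 t x - rho0) = 0;
  vlasov_weak : forall (n : nat) (t : R),
    (n < NH)%N -> 0 < t -> (t%:E < T)%E ->
    forall phi dphi, inV L phi -> weak_derivative L phi dphi ->
    let a := alpha L alpha0 gamma E in
    derive1 (fun s =>
      \int[lebesgue_measure]_(x in `[0, L]) (C n%:Z s x * phi x)) t
    - derive1 a t / a t *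
      (\int[lebesgue_measure]_(x in `[0, L])
         ((n%:R * C n%:Z t x
           + Num.sqrt ((n%:R - 1) * n%:R) * C (n%:Z - 2) t x) * phi x))
    - (a t)^-1 *
      (\int[lebesgue_measure]_(x in `[0, L])
         ((Num.sqrt n%:R * C (n%:Z - 1) t x
           + Num.sqrt (n%:R + 1) * C (n%:Z + 1) t x) * dphi x))
    - a t * Num.sqrt n%:R *
      (\int[lebesgue_measure]_(x in `[0, L])
         (E t x * C (n%:Z - 1) t x * phi x)) = 0;
  potential_weak : forall t : R, 0 <= t -> (t%:E < T)%E ->
    forall eta deta, inV L eta -> weak_derivative L eta deta ->
    \int[lebesgue_measure]_(x in `[0, L]) (Phi t x * deta x) =
    \int[lebesgue_measure]_(x in `[0, L]) (E t x * eta x);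
  poisson_weak : forall t : R, 0 <= t -> (t%:E < T)%E ->
    forall zeta dzeta, inV L zeta -> weak_derivative L zeta dzeta ->
    - (\int[lebesgue_measure]_(x in `[0, L]) (E t x * dzeta x)) =
    \int[lebesgue_measure]_(x in `[0, L]) ((C 0 t x - rho0) * zeta x)
}.

Definition moment (R : realType) (L alpha0 gamma : R)
    (C : int -> R -> R -> R) (E : R -> R -> R) (k : nat) (t : R) : R :=
  \int[lebesgue_measure]_(x in `[0, L])
     (C k%:Z t x / alpha L alpha0 gamma E t ^+ k).

(* For NH = 1 or 2 the equation for C_2 is not part of the truncated system and
   the energy is in general not conserved. For instance, with NH = 1,
   L = 2 * pi and rho0 = 1, a stationary solution is C_0 = 1 + cos x,
   E = sin x, Phi = cos x, whereas 1 / alpha ^ 2 grows linearly in time. *)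
Definition energy (R : realType) (L alpha0 gamma : R)
    (C : int -> R -> R -> R) (E : R -> R -> R) (t : R) : R :=
  2^-1 * (\int[lebesgue_measure]_(x in `[0, L])
     ((alpha L alpha0 gamma E t ^+ 2)^-1 * (Num.sqrt 2 * C 2 t x + C 0 t x)
      + `|E t x| ^+ 2)).

(* Main.v *)
Require Import Defs.
From mathcomp Require Import all_boot all_order all_algebra.
From mathcomp Require Import all_classical all_reals all_analysis.
From mathcomp Require Import measurable_realfun.
From mathcomp Require Import ring lra.

(* Poisson's equation makes E(t) a C^1 function of x with E' = C_0 - rho0, and
   the equation for the potential gives it zero mean, so that the sup norm of
   E(s) - E(t) is controlled by the L^2 norm of C_0(s) - C_0(t). Hence
   the sup norm of E is continuous in time and alpha is differentiable.
   Mass is quasi-neutrality; momentum follows from the equation for C_1 tested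
   with 1, since the integral of E C_0 is that of E E' + rho0 E, which vanishes.
   For the energy, the equation for C_2 tested with 1 gives the kinetic part the
   derivative (1/alpha) int E C_1. Let psi be a periodic antiderivative of
   - E(t). By parts, int E(s) E(t) = int (C_0(s) - rho0) psi, and the equation
   for C_0 tested with psi gives this the derivative - (1/alpha) int E C_1 at
   s = t. Since int (E(s) - E(t))^2 = o(s - t), this is the derivative of the
   electric energy. *)

Import Order.TTheory GRing.Theory Num.Theory.
Import numFieldNormedType.Exports.

Local Open Scope classical_set_scope.
Local Open Scope ring_scope.

Set Implicit Arguments.
Unset Strict Implicit.

Section calculus.
Context {R : realType}.
Notation mu := (@lebesgue_measure R).
Implicit Types (f g F G u : R -> R) (a b x L : R).

Lemma continuous_itv_integrable f a b :
  continuous f -> mu.-integrable `[a, b] (EFin \o f).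
Proof.
move=> cf; apply: continuous_compact_integrable; first exact: segment_compact.
exact: continuous_subspaceT.
Qed.

Lemma is_derive1_continuous F f :
  (forall x, is_derive x 1 F (f x)) -> continuous F.
Proof.
move=> dF x; apply/differentiable_continuous/derivable1_diffP.
by have [] := dF x.
Qed.

Lemma is_derive1_ge0_homo F f : (forall x, is_derive x 1 F (f x)) ->
  (forall x, 0 <= f x) -> {homo F : x y / x <= y}.
Proof.
move=> dF f0 x y xy.
have [|c _ e] := @MVT_segment R F f x y xy (fun z _ => dF z).
- by apply: continuous_subspaceT; exact: is_derive1_continuous dF.
- by rewrite -subr_ge0 e mulr_ge0 ?f0 // subr_ge0.
Qed.

Lemma antiderivative f : continuous f ->
  exists F, forall x, is_derive x 1 F (f x).
Proof.
move=> cf.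
have fi c d : mu.-integrable `[c, d] (EFin \o f).
  exact: continuous_itv_integrable.
have itv_split c d e : c <= d -> d <= e -> \int[mu]_(x in `[c, e]) f x =
    \int[mu]_(x in `[c, d]) f x + \int[mu]_(x in `[d, e]) f x.
  move=> cd de; rewrite -[X in _ + X]Rintegral_itv_obnd_cbnd.
    rewrite -(@Rintegral_itvB _ f (BLeft c) (BRight e) d) ?bnd_simp//.
    by rewrite addrC subrK.
  apply: integrableS (fi d e) => //; exact: subset_itv_oc_cc.
pose J M x := \int[mu]_(t in `[- M, x]) f t - \int[mu]_(t in `[- M, 0]) f t.
have JE M N x : 0 <= N -> N <= M -> - N <= x -> J N x = J M x.
  move=> N0 NM Nx; rewrite /J (itv_split (- M) (- N) x) ?lerN2//.
  by rewrite (itv_split (- M) (- N) 0) ?lerN2// ?oppr_le0//; lra.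
exists (fun x => J (x ^+ 2 + 1) x) => x.
pose M := (`|x| + 1) ^+ 2 + 1.
have M0 : 0 < M by rewrite /M; nra.
have xM : - M < x.
  have : - x <= `|x| by rewrite -normrN ler_norm.
  have := normr_ge0 x; rewrite /M; nra.
have [dM DM] := @continuous_FTC1_closed R f (- M) x (x + 1) ltac:(lra)
  (fi _ _) xM (cf x).
have dJ : is_derive x 1 (J M) (f x).
  rewrite -[f x]subr0; apply: is_deriveB.
  by apply: DeriveDef; [exact: dM|rewrite -derive1E; exact: DM].
apply: near_eq_is_derive dJ.
near=> y; apply/esym; apply: JE.
- by nra.
- rewrite /M lerD2r.
  have yx : `|y| <= `|x| + 1.
    have : `|x - y| < 1 by near: y; apply: cvgr_dist_lt.
    by have := ler_normD x (y - x); rewrite addrC subrK (distrC y x); lra.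
  by rewrite -(real_normK (num_real y)); have := normr_ge0 y; nra.
- by nra.
Unshelve. all: by end_near. Qed.

Lemma Rintegral_is_derive F f a b : a <= b -> continuous f ->
  (forall x, is_derive x 1 F (f x)) ->
  \int[mu]_(x in `[a, b]) f x = F b - F a.
Proof.
rewrite le_eqVlt => /predU1P[->|ab] cf dF.
  by rewrite set_itv1 Rintegral_set1 subrr.
have cF := is_derive1_continuous dF.
rewrite /Rintegral (@continuous_FTC2 R f F a b ab) //.
- exact: continuous_subspaceT.
- split; first by move=> x _; have [] := dF x.
  + exact: cvg_at_right_filter (cF a).
  + exact: cvg_at_left_filter (cF b).
- by move=> x _; rewrite derive1E; apply: derive_val; exact: dF.
Qed.

Lemma periodic_is_derive F f L : 0 <= L -> continuous f ->
  (forall x, is_derive x 1 F (f x)) -> (forall x, f (x + L) = f x) ->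
  \int[mu]_(x in `[0, L]) f x = 0 -> forall x, F (x + L) = F x.
Proof.
move=> L0 cf dF pf; rewrite (Rintegral_is_derive L0 cf dF) => FL x.
suff : F (x + L) - F x = F (0 + L) - F 0 by rewrite add0r FL; lra.
apply: (@is_derive_0_is_cst _ (fun x => F (x + L) - F x)) => y.
have dFL : is_derive y 1 (F \o (fun x => x + L)) (f (y + L) * (1 + 0)).
  exact: is_derive1_comp.
have := is_deriveB dFL (dF y).
by rewrite addr0 mulr1 pf subrr.
Qed.

Lemma periodic_Rintegral_eq0 f L : 0 < L -> continuous f ->
  (forall x, f (x + L) = f x) -> (forall x, 0 <= f x) ->
  \int[mu]_(x in `[0, L]) f x = 0 -> forall x, f x = 0.
Proof.
move=> L0 cf pf f0 If x; have [F dF] := antiderivative cf.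
have pF := periodic_is_derive (ltW L0) cf dF pf If.
have hF := is_derive1_ge0_homo dF f0.
rewrite -(@derive_val _ _ _ _ _ _ _ (dF x)).
rewrite -[RHS](@derive_val _ _ _ x 1 _ _ (is_derive_cst (F x) x 1)).
apply: near_eq_derive; near=> y.
have : `|x - y| < L by near: y; apply: cvgr_dist_lt.
rewrite ltr_distl => /andP[xy yx]; apply/eqP; rewrite eq_le; apply/andP; split.
- by rewrite -(pF x) hF//; lra.
- by rewrite -(pF y) hF//; lra.
Unshelve. all: by end_near. Qed.

End calculus.

Section continuity.
Context {R : realType}.
Implicit Types f g : R -> R.

Lemma cont_cst (c : R) : continuous (fun _ : R => c).
Proof. by move=> x; exact: cvg_cst. Qed.

Lemma contD f g : continuous f -> continuous g ->
  continuous (fun x => f x + g x).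
Proof. by move=> cf cg x; apply: cvgD; [exact: cf|exact: cg]. Qed.

Lemma contN f : continuous f -> continuous (fun x => - f x).
Proof. by move=> cf x; apply: cvgN; exact: cf. Qed.

Lemma contM f g : continuous f -> continuous g ->
  continuous (fun x => f x * g x).
Proof. by move=> cf cg x; apply: cvgM; [exact: cf|exact: cg]. Qed.

Lemma contX f n : continuous f -> continuous (fun x => f x ^+ n).
Proof.
move=> cf; elim: n => [|n IH]; first exact: cont_cst.
by under eq_fun do rewrite exprS; exact: contM.
Qed.

Lemma cont_norm f : continuous f -> continuous (fun x => `|f x|).
Proof. by move=> cf x; apply: cvg_norm; exact: cf. Qed.

End continuity.

Ltac cts := repeat match goal with
  | H : continuous ?f |- continuous ?f => exact: H
  | |- continuous (fun x => @?f x + @?g x) => apply: (@contD _ f g)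
  | |- continuous (fun x => - (@?f x)) => apply: (@contN _ f)
  | |- continuous (fun x => @?f x * @?g x) => apply: (@contM _ f g)
  | |- continuous (fun x => @?f x ^+ ?n) => apply: (@contX _ f n)
  | |- continuous (fun x => `|@?f x|) => apply: (@cont_norm _ f)
  | |- continuous _ => first [assumption | exact: cont_cst]
  end.

Section integrals.
Context {R : realType} (L : R) (L_gt0 : 0 < L).
Notation mu := (@lebesgue_measure R).
Notation Int f := (\int[mu]_(x in `[0, L]) (f x)).
Implicit Types (f g F G u v : R -> R) (x : R).

Lemma Rintegral_contD f g : continuous f -> continuous g ->
  \int[mu]_(x in `[0, L]) (f x + g x) = Int f + Int g.
Proof.
by move=> cf cg; rewrite RintegralD //; exact: continuous_itv_integrable.
Qed.

Lemma Rintegral_contB f g : continuous f -> continuous g ->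
  \int[mu]_(x in `[0, L]) (f x - g x) = Int f - Int g.
Proof.
by move=> cf cg; rewrite RintegralB //; exact: continuous_itv_integrable.
Qed.

Lemma Rintegral_contZ c f : continuous f ->
  \int[mu]_(x in `[0, L]) (c * f x) = c * Int f.
Proof.
by move=> cf; rewrite RintegralZl //; exact: continuous_itv_integrable.
Qed.

Lemma le_Rintegral_cont f g : continuous f -> continuous g ->
  (forall x, 0 <= x <= L -> f x <= g x) -> Int f <= Int g.
Proof.
by move=> cf cg fg; apply: le_Rintegral => //; exact: continuous_itv_integrable.
Qed.

Lemma Rintegral_itv_cst (c : R) : \int[mu]_(x in `[0, L]) c = c * L.
Proof.
rewrite Rintegral_cst; last exact: measurable_itv.
by rewrite /= lebesgue_measure_itv /= lte_fin L_gt0 /= subr0.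
Qed.

Lemma Rintegral_sqr_ge0 f : 0 <= \int[mu]_(x in `[0, L]) (f x ^+ 2).
Proof. by apply: Rintegral_ge0 => x _; exact: sqr_ge0. Qed.

Lemma Rintegral_cont_lin a b f g : continuous f -> continuous g ->
  \int[mu]_(x in `[0, L]) (a * f x + b * g x) = a * Int f + b * Int g.
Proof. by move=> cf cg; rewrite Rintegral_contD ?Rintegral_contZ//; cts. Qed.

(* [D f - B g] with [B = Int (f * g)] and [D = Int (g ^+ 2)] is, up to the
   factor [D], the component of [f] orthogonal to [g]. *)
Lemma cauchy_schwarz f g : continuous f -> continuous g ->
  (\int[mu]_(x in `[0, L]) (f x * g x)) ^+ 2 <=
  \int[mu]_(x in `[0, L]) (f x ^+ 2) * \int[mu]_(x in `[0, L]) (g x ^+ 2).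
Proof.
move=> cf cg.
have expand a b : \int[mu]_(x in `[0, L]) ((a * f x + b * g x) ^+ 2) =
    a ^+ 2 * \int[mu]_(x in `[0, L]) (f x ^+ 2)
    + (2 * a * b) * \int[mu]_(x in `[0, L]) (f x * g x)
    + b ^+ 2 * \int[mu]_(x in `[0, L]) (g x ^+ 2).
  rewrite -!Rintegral_contZ -?Rintegral_contD; cts.
  by apply: eq_Rintegral => x _; ring.
set A := \int[mu]_(x in `[0, L]) (f x ^+ 2).
set B := \int[mu]_(x in `[0, L]) (f x * g x).
set D := \int[mu]_(x in `[0, L]) (g x ^+ 2).
have D0 : 0 <= D by exact: Rintegral_sqr_ge0.
have pos a b : 0 <= a ^+ 2 * A + (2 * a * b) * B + b ^+ 2 * D.
  by rewrite -expand; exact: Rintegral_sqr_ge0.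
move: D0; rewrite le_eqVlt => /predU1P[D0|D0].
  have := pos B (- (A + 1)); rewrite -D0 mulr0 addr0 => h.
  have A0 : 0 <= A by exact: Rintegral_sqr_ge0.
  by rewrite mulr0; nra.
have := pos D (- B); rewrite -(pmulr_rge0 _ D0) => h.
rewrite -subr_ge0 -(pmulr_rge0 _ D0) -(pmulr_rge0 _ D0).
by move: h; congr (0 <= _); ring.
Qed.

Lemma cauchy_schwarz1 f : continuous f ->
  Int f ^+ 2 <= L * \int[mu]_(x in `[0, L]) (f x ^+ 2).
Proof.
move=> cf; have := cauchy_schwarz cf (@cont_cst _ 1).
under eq_Rintegral do rewrite mulr1.
under [X in _ * X]eq_Rintegral do rewrite expr1n.
by rewrite Rintegral_itv_cst mul1r mulrC.
Qed.

Lemma Rintegral_by_parts F G f g : continuous f -> continuous g ->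
  (forall x, is_derive x 1 F (f x)) -> (forall x, is_derive x 1 G (g x)) ->
  \int[mu]_(x in `[0, L]) (F x * g x) + \int[mu]_(x in `[0, L]) (f x * G x)
  = F L * G L - F 0 * G 0.
Proof.
move=> cf cg dF dG.
have cF := is_derive1_continuous dF.
have cG := is_derive1_continuous dG.
rewrite -Rintegral_contD; cts.
have dFG x : is_derive x 1 (F * G) (F x * g x + f x * G x).
  by have := is_deriveM (dF x) (dG x); rewrite /GRing.scale /= [G x * _]mulrC.
by rewrite (Rintegral_is_derive (ltW L_gt0) _ dFG) //; cts.
Qed.

Lemma continuous_L2 f : continuous f -> L2 L f.
Proof.
move=> cf; split; last by apply: continuous_itv_integrable; cts.
by apply: measurable_funTS; exact: continuous_measurable_fun.
Qed.

Lemma is_derive_weak_derivative F f : continuous f ->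
  (forall x, is_derive x 1 F (f x)) -> weak_derivative L F f.
Proof.
move=> cf dF; split; first exact: continuous_L2.
move=> phi [dphi cphi [a [b [a0 bL phi0]]]].
have dp x : is_derive x 1 phi (derive1 phi x).
  by rewrite derive1E; apply: DeriveDef.
have := Rintegral_by_parts cf cphi dF dp.
rewrite (phi0 L) ?(phi0 0) ?mulr0 ?subrr.
- by move/eqP; rewrite addr_eq0 => /eqP.
- by rewrite in_itv /=; apply/negP => /andP[]; lra.
- by rewrite in_itv /=; apply/negP => /andP[]; lra.
Qed.

Lemma is_derive_inV F f : continuous f -> (forall x, is_derive x 1 F (f x)) ->
  (forall x, F (x + L) = F x) -> inV L F.
Proof.
move=> cf dF pF; have cF := is_derive1_continuous dF; split=> //.
split; first exact: continuous_L2.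
by exists f; exact: is_derive_weak_derivative.
Qed.

(* Testing against an antiderivative of [u - G] minus its mean, where [G' = g],
   shows that [u - G] is constant. *)
Lemma weak_is_derive u g : continuous u -> continuous g ->
  (forall x, u (x + L) = u x) -> (forall x, g (x + L) = g x) ->
  Int g = 0 ->
  (forall z dz, inV L z -> weak_derivative L z dz ->
    - (\int[mu]_(x in `[0, L]) (u x * dz x)) =
    \int[mu]_(x in `[0, L]) (g x * z x)) ->
  forall x, is_derive x 1 u (g x).
Proof.
move=> cu cg pu pg Ig wug.
have [G dG] := antiderivative cg.
have cG := is_derive1_continuous dG.
have pG := periodic_is_derive (ltW L_gt0) cg dG pg Ig.
pose m := (Int u - Int G) / L.
pose w x := u x - G x - m.
have cw : continuous w by rewrite /w; cts.
have pw x : w (x + L) = w x by rewrite /w pu pG.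
have Iw : Int w = 0.
  rewrite /w !Rintegral_contB; cts.
  by rewrite Rintegral_itv_cst /m mulfVK ?subrr// gt_eqF.
have [z dz] := antiderivative cw.
have cz := is_derive1_continuous dz.
have pz := periodic_is_derive (ltW L_gt0) cw dz pw Iw.
have := wug z w (is_derive_inV cw dz pz) (is_derive_weak_derivative cw dz).
have := Rintegral_by_parts cg cw dG dz.
have -> : G L = G 0 by rewrite -[in LHS](add0r L) pG.
have -> : z L = z 0 by rewrite -[in LHS](add0r L) pz.
rewrite subrr => Gz uz.
have w0 : forall x, w x ^+ 2 = 0.
  apply: (periodic_Rintegral_eq0 L_gt0).
  - by cts.
  - by move=> x; rewrite pw.
  - by move=> x; exact: sqr_ge0.
  transitivity (\int[mu]_(x in `[0, L]) (u x * w x - G x * w x - m * w x)).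
    by apply: eq_Rintegral => x _; rewrite /w; ring.
  rewrite !Rintegral_contB; cts; rewrite Rintegral_contZ// Iw; lra.
have uE : u = G + cst m.
  apply/funext => x; have /eqP := w0 x.
  by rewrite sqrf_eq0 /w subr_eq0 subr_eq addrC => /eqP.
by move=> x; rewrite uE -[g x]addr0; exact: is_deriveD.
Qed.

Lemma mean0_sup_bound u g : continuous g -> (forall x, is_derive x 1 u (g x)) ->
  Int u = 0 -> forall x, 0 <= x <= L ->
  u x ^+ 2 <= L * \int[mu]_(x in `[0, L]) (g x ^+ 2).
Proof.
move=> cg du Iu x x0L.
have cu := is_derive1_continuous du.
have cng : continuous (fun x => `|g x|) by cts.
have [Q dQ] := antiderivative cng.
set K := \int[mu]_(x in `[0, L]) `|g x|.
have KE : K = Q L - Q 0 by apply: (Rintegral_is_derive (ltW L_gt0) cng).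
have hp : {homo Q + u : x y / x <= y}.
  apply: (@is_derive1_ge0_homo _ _ (fun x => `|g x| + g x)).
  by move=> y; have := ler_norm (- g y); rewrite normrN; lra.
have hm : {homo Q - u : x y / x <= y}.
  apply: (@is_derive1_ge0_homo _ _ (fun x => `|g x| - g x)).
  by move=> y; have := ler_norm (g y); lra.
have hQ : {homo Q : x y / x <= y}.
  by apply: (@is_derive1_ge0_homo _ _ (fun x => `|g x|)).
have osc y : 0 <= y <= L -> `|u x - u y| <= K.
  move: x0L => /andP[x0 xL] /andP[y0 yL]; rewrite KE ler_norml.
  have {}hp a b : a <= b -> Q a + u a <= Q b + u b by exact: hp.
  have {}hm a b : a <= b -> Q a - u a <= Q b - u b by exact: hm.
  have := hQ 0 x x0; have := hQ x L xL; have := hQ 0 y y0; have := hQ y L yL.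
  by have [xy|/ltW xy] := leP x y; have := hp _ _ xy; have := hm _ _ xy; lra.
have lo : \int[mu]_(y in `[0, L]) (u x - K) <= Int u.
  by apply: le_Rintegral_cont; cts => y /osc; rewrite ler_norml; lra.
have up : Int u <= \int[mu]_(y in `[0, L]) (u x + K).
  by apply: le_Rintegral_cont; cts => y /osc; rewrite ler_norml; lra.
rewrite Rintegral_itv_cst Iu pmulr_lle0// in lo.
rewrite Rintegral_itv_cst Iu pmulr_lge0// in up.
have uK : `|u x| <= K.
  by rewrite ler_norml; lra.
have := cauchy_schwarz1 cng; rewrite -/K.
under eq_Rintegral do rewrite real_normK ?num_real//.
apply: le_trans; rewrite -(real_normK (num_real (u x))).
by rewrite lerXn2r ?nnegrE ?normr_ge0// (le_trans _ uK).
Qed.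

End integrals.

Section time.
Context {R : realType} (L : R) (L_gt0 : 0 < L).
Notation mu := (@lebesgue_measure R).
Notation Int f := (\int[mu]_(x in `[0, L]) (f x)).
Implicit Types (f g v : R -> R) (u : R -> R -> R) (t : R).

Lemma sqr_cvg {T : Type} (F : set_system T) {FF : Filter F} (X Y : T -> R)
    (l : R) :
  (\forall z \near F, (X z - l) ^+ 2 <= Y z) -> Y z @[z --> F] --> 0 ->
  X z @[z --> F] --> l.
Proof.
move=> XY Y0; apply/cvgrPdist_lt => e e0; near=> z.
have Yz : Y z < e ^+ 2.
  have : `|0 - Y z| < e ^+ 2.
    by near: z; apply: cvgr_dist_lt => //; rewrite exprn_gt0.
  by rewrite sub0r normrN; apply: le_lt_trans; exact: ler_norm.
have : (X z - l) ^+ 2 <= Y z by near: z.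
rewrite distrC -(real_normK (num_real (X z - l))) => h.
by rewrite -(ltr_pXn2r (n := 2)) ?nnegrE ?(ltW e0)//; exact: le_lt_trans h Yz.
Unshelve. all: by end_near. Qed.

Lemma cvg_is_derive1 f t (d : R) :
  (f (t + h) - f t) / h @[h --> 0^'] --> d -> is_derive t 1 f d.
Proof.
move=> fd.
have fd' : h^-1 *: ((f \o shift t) (h *: (1 : R)) - f t) @[h --> 0^'] --> d.
  apply: cvg_trans fd; apply: near_eq_cvg; near=> h.
  by rewrite /= /GRing.scale /= mulr1 mulrC (addrC h).
by apply: DeriveDef; [apply/cvg_ex; exists d|apply: cvg_lim].
Unshelve. all: by end_near. Qed.

Lemma near0_shift (P : R -> Prop) t :
  (\forall s \near t, P s) -> \forall h \near (0 : R)^', P (t + h).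
Proof.
move=> Pt; apply: cvg_within.
have : (fun h : R => t + h) h @[h --> 0] --> t + 0.
  by apply: cvgD; [exact: cvg_cst|exact: cvg_id].
by rewrite addr0; apply.
Qed.

Lemma pairing_is_derive u t v f :
  (\forall s \near t, continuous (u s)) -> continuous v -> continuous f ->
  time_derivative L u t v ->
  is_derive t 1 (fun s => \int[mu]_(x in `[0, L]) (u s x * f x))
    (\int[mu]_(x in `[0, L]) (v x * f x)).
Proof.
move=> cu cv cf uv; apply: cvg_is_derive1.
have ct : continuous (u t) by exact: nbhs_singleton cu.
set K := \int[mu]_(x in `[0, L]) (f x ^+ 2).
pose e h := \int[mu]_(x in `[0, L]) (((u (t + h) x - u t x) / h - v x) ^+ 2).
apply: (sqr_cvg (Y := fun h => e h * K)); last first.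
  by rewrite -[X in _ --> X](mul0r K); apply: cvgM; [exact: uv|exact: cvg_cst].
have := near0_shift cu; apply: filterS => h cth.
rewrite (_ : _ - _ = \int[mu]_(x in `[0, L])
  (((u (t + h) x - u t x) / h - v x) * f x)).
  by apply: cauchy_schwarz => //; cts.
rewrite mulrC -Rintegral_contB -?Rintegral_contZ -?Rintegral_contB; cts.
by apply: eq_Rintegral => x _; ring.
Qed.

Lemma square_increment_cvg u t v :
  (\forall s \near t, continuous (u s)) -> continuous v ->
  time_derivative L u t v ->
  (\int[mu]_(x in `[0, L]) ((u (t + h) x - u t x) ^+ 2)) / h @[h --> 0^'] --> 0.
Proof.
move=> cu cv uv.
have ct : continuous (u t) by exact: nbhs_singleton cu.
set K := \int[mu]_(x in `[0, L]) (v x ^+ 2).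
pose e h := \int[mu]_(x in `[0, L]) (((u (t + h) x - u t x) / h - v x) ^+ 2).
apply/norm_cvg0P.
apply: (@squeeze_cvgr _ _ _ _ (cst 0) (fun h => `|h| * (2 * e h + 2 * K))).
- near=> h; apply/andP; split; first exact: normr_ge0.
  have h0 : h != 0 by near: h; exact: nbhs_dnbhs_neq.
  have cth : continuous (u (t + h)).
    by near: h; exact: (@near0_shift (fun s => continuous (u s))).
  rewrite normrM normfV (ger0_norm (Rintegral_sqr_ge0 _ _)).
  rewrite ler_pdivrMr ?normr_gt0// mulrAC -expr2 real_normK ?num_real//.
  rewrite -!Rintegral_contZ -?Rintegral_contD -?Rintegral_contZ; cts.
  apply: le_Rintegral_cont => //; cts => x _.
  set q := (u (t + h) x - u t x) / h.
  have -> : u (t + h) x - u t x = h * q by rewrite /q mulrC divfK.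
  by rewrite exprMn ler_wpM2l ?sqr_ge0//; have := sqr_ge0 (q - 2 * v x); nra.
- exact: cvg_cst.
- have : `|h| * (2 * e h + 2 * K) @[h --> (0 : R)^'] --> `|0 : R| * (2 * 0 + 2 * K).
    apply: cvgM.
      by apply: cvg_norm; exact: cvg_within.
    by apply: cvgD; [apply: cvgM; [exact: cvg_cst|exact: uv]|exact: cvg_cst].
  by rewrite normr0 mul0r.
Unshelve. all: by end_near. Qed.

Lemma is_derive_square_increment u t v f (K : R) :
  (\forall s \near t, continuous (u s)) -> continuous v ->
  time_derivative L u t v -> f t = 0 ->
  (\forall s \near t,
     0 <= f s <= K * \int[mu]_(x in `[0, L]) ((u s x - u t x) ^+ 2)) ->
  is_derive t 1 f 0.
Proof.
move=> cu cv uv ft fK; apply: cvg_is_derive1; rewrite ft; apply/norm_cvg0P.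
have ucvg := square_increment_cvg cu cv uv.
pose D h := \int[mu]_(x in `[0, L]) ((u (t + h) x - u t x) ^+ 2).
apply: (@squeeze_cvgr _ _ _ _ (cst 0) (fun h => `|K * (D h / h)|)).
- have := near0_shift fK; apply: filterS => h /andP[f0 fKh].
  apply/andP; split; first exact: normr_ge0.
  rewrite subr0 mulrA [leLHS]normrM [leRHS]normrM ler_wpM2r // (ger0_norm f0).
  exact: le_trans fKh (ler_norm _).
- exact: cvg_cst.
- have : `|K * (D h / h)| @[h --> (0 : R)^'] --> `|K * 0|.
    by apply: cvg_norm; apply: cvgM; [exact: cvg_cst|exact: ucvg].
  by rewrite mulr0 normr0.
Qed.

Lemma right_continuous_pairing u f :
  (\forall h \near (0 : R)^'+, continuous (u h)) -> continuous (u 0) ->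
  continuous f -> time_right_continuous0 L u ->
  \int[mu]_(x in `[0, L]) (u h x * f x) @[h --> 0^'+] -->
  \int[mu]_(x in `[0, L]) (u 0 x * f x).
Proof.
move=> cu c0 cf uv.
set K := \int[mu]_(x in `[0, L]) (f x ^+ 2).
apply: (sqr_cvg (Y := fun h =>
  \int[mu]_(x in `[0, L]) ((u h x - u 0 x) ^+ 2) * K)); last first.
  by rewrite -[X in _ --> X](mul0r K); apply: cvgM; [exact: uv|exact: cvg_cst].
move: cu; apply: filterS => h ch.
rewrite -Rintegral_contB; cts.
under eq_Rintegral do rewrite -mulrBl.
by apply: cauchy_schwarz => //; cts.
Qed.

Lemma supnorm_has_sup f : continuous f -> has_sup [set `|f x| | x in `[0, L]].
Proof.
move=> cf; split.
  by exists `|f 0|; exists 0 => //=; rewrite in_itv /= lexx ltW.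
have [|c _ hc] := @EVT_max R (fun x => `|f x|) 0 L (ltW L_gt0).
  by apply: continuous_subspaceT; cts.
by exists `|f c| => _ [x xL <-]; exact: hc.
Qed.

Lemma supnorm_dist f g (K : R) : continuous f -> continuous g ->
  (forall x, 0 <= x <= L -> (f x - g x) ^+ 2 <= K) ->
  (supnorm L f - supnorm L g) ^+ 2 <= K.
Proof.
move=> cf cg fg.
have K0 : 0 <= K by apply: le_trans (fg 0 _); rewrite ?sqr_ge0 // lexx ltW.
have le (k h : R -> R) : continuous k -> continuous h ->
    (forall x, 0 <= x <= L -> (k x - h x) ^+ 2 <= K) ->
    supnorm L k <= supnorm L h + Num.sqrt K.
  move=> ck ch kh; apply: ge_sup; first by have [] := supnorm_has_sup ck.
  move=> _ [x xL <-].
  have hx : `|h x| <= supnorm L h.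
    apply: ub_le_sup; first by have [] := supnorm_has_sup ch.
    by exists x.
  have dx : `|k x - h x| <= Num.sqrt K.
    rewrite -sqrtr_sqr ler_wsqrtr// kh//.
  have := ler_normD (k x - h x) (h x); rewrite subrK; lra.
have := le f g cf cg fg.
have : supnorm L g <= supnorm L f + Num.sqrt K.
  by apply: le => // x xL; rewrite -sqrrN opprB fg.
move=> gf fg'; rewrite -[leRHS]sqr_sqrtr// -(real_normK (num_real (_ - _))).
by rewrite lerXn2r ?nnegrE ?sqrtr_ge0// ler_norml; lra.
Qed.

Lemma near_fin_lt (T : \bar R) t : (t%:E < T)%E ->
  \forall s \near t, (s%:E < T)%E.
Proof.
case: T => [r| |].
- by rewrite lte_fin => tr; near=> s; rewrite lte_fin; near: s; exact: lt_nbhsl.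
- by move=> _; near=> s; rewrite ltry.
- by rewrite ltNge leNye.
Unshelve. all: by end_near. Qed.

End time.

Section scaling.
Context {R : realType} (L alpha0 gamma : R) (T : \bar R) (E : R -> R -> R).
Hypotheses (alpha0_gt0 : 0 < alpha0) (gamma_gt0 : 0 < gamma).
Notation mu := (@lebesgue_measure R).
Let S (s : R) := supnorm L (E s) ^+ 2.
Hypothesis S_cont : forall t, 0 < t -> (t%:E < T)%E -> {for t, continuous S}.
Hypothesis S_cont0 : S h @[h --> 0^'+] --> S 0.

Let base_gt0 t : 0 < 1 + gamma * \int[mu]_(s in `[0, t]) S s.
Proof.
apply: ltr_pwDl => //; apply: mulr_ge0; first exact: ltW.
by apply: Rintegral_ge0 => x _; exact: sqr_ge0.
Qed.

Lemma alpha_gt0 t : 0 < alpha L alpha0 gamma E t.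
Proof. by rewrite mulr_gt0 // powR_gt0 //; exact: base_gt0. Qed.

Let S_int b : 0 < b -> (b%:E < T)%E -> mu.-integrable `[0, b] (EFin \o S).
Proof.
move=> b0 bT; apply: continuous_compact_integrable; first exact: segment_compact.
apply/continuous_within_itvP => //; split=> //.
  move=> x; rewrite in_itv /= => /andP[x0 xb]; apply: S_cont => //.
  by apply: lt_trans bT; rewrite lte_fin.
exact: cvg_at_left_filter (S_cont b0 bT).
Qed.

Let ex_between t : (t%:E < T)%E -> exists2 b, t < b & (b%:E < T)%E.
Proof.
move=> /near_fin_lt tT.
have : \forall s \near t^'+, t < s /\ (s%:E < T)%E.
  near=> s; split; first by near: s; exact: nbhs_right_gt.
  by near: s; apply: cvg_within.
by move=> /filter_ex[b [tb bT]]; exists b.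
Unshelve. all: by end_near. Qed.

Lemma alpha_is_derive t : 0 < t -> (t%:E < T)%E ->
  is_derive t 1 (alpha L alpha0 gamma E) (derive1 (alpha L alpha0 gamma E) t).
Proof.
move=> t0 tT; rewrite derive1E; apply: DeriveDef => //.
have [b tb bT] := ex_between tT.
have [dJ _] := continuous_FTC1_closed tb (S_int (lt_trans t0 tb) bT) t0
  (S_cont t0 tT).
pose J (r : R) : R := \int[mu]_(s in `[0, r]) S s.
have {}dJ : is_derive t 1 J ('D_1 J t) by exact: DeriveDef.
have db : is_derive t 1 (cst 1 + gamma \*: J) (0 + gamma *: 'D_1 J t).
  exact: is_deriveD.
have dp := is_derive1_powR (- 2^-1) (base_gt0 t).
have dc := @is_derive1_comp R _ (cst 1 + gamma \*: J) t _ _ dp db.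
by have [] := is_deriveZ alpha0 dc.
Qed.

Lemma alpha_cvg0 : (0%:E < T)%E ->
  alpha L alpha0 gamma E h @[h --> 0^'+] --> alpha L alpha0 gamma E 0.
Proof.
move=> T0; have [b b0 bT] := ex_between T0.
rewrite {2}/alpha; apply: cvgM; first exact: cvg_cst.
have J0 : \int[mu]_(s in `[0, 0]) S s = 0 by rewrite set_itv1 Rintegral_set1.
have Jh : \int[mu]_(s in `[0, h]) S s @[h --> 0^'+] --> 0.
  apply: cvg_at_right_filter.
  exact: (parameterized_integral_cvg_left b0 (S_int b0 bT)).
rewrite -/(S _) J0.
have c1 : 1 + gamma * \int[mu]_(s in `[0, h]) S s @[h --> 0^'+] --> 1 + gamma * 0.
  by apply: cvgD; [exact: cvg_cst|apply: cvgM => //; exact: cvg_cst].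
have b1 : 0 < 1 + gamma * 0 :> R by rewrite mulr0 addr0.
have cp : {for 1 + gamma * 0, continuous (fun z : R => z `^ (- 2^-1))}.
  apply/differentiable_continuous/derivable1_diffP.
  by have [] := is_derive1_powR (- 2^-1) b1.
exact: (cvg_comp _ _ c1 cp).
Qed.

End scaling.

Section solution.
Context {R : realType} (L alpha0 gamma rho0 : R) (NH : nat) (T : \bar R).
Context (C : int -> R -> R -> R) (Phi E : R -> R -> R).
Hypotheses (L_gt0 : 0 < L) (alpha0_gt0 : 0 < alpha0) (gamma_gt0 : 0 < gamma).
Hypothesis sol : hermite_solution L alpha0 gamma rho0 NH T C Phi E.
Notation mu := (@lebesgue_measure R).
Notation a := (alpha L alpha0 gamma E).
Notation P n := (fun s => \int[mu]_(x in `[0, L]) (C n s x)).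
Notation Q := (fun s => \int[mu]_(x in `[0, L]) (E s x ^+ 2)).
Implicit Types (s t x : R) (n : nat).

Lemma C_eq0 (n : int) t : NH%:Z <= n -> C n t = fun=> 0.
Proof.
by move=> h; apply/funext => x; apply: (C_truncation sol); rewrite h orbT.
Qed.

Lemma C_periodic_continuous n t : 0 <= t -> (t%:E < T)%E ->
  continuous (C n%:Z t) /\ forall x, C n%:Z t (x + L) = C n%:Z t x.
Proof.
move=> t0 tT; have [nNH|NHn] := ltnP n NH.
  by have [] := C_inV sol nNH t0 tT.
by rewrite C_eq0 ?lez_nat//; split=> //; exact: cont_cst.
Qed.

Lemma C_continuous n t : 0 <= t -> (t%:E < T)%E -> continuous (C n%:Z t).
Proof. by move=> t0 tT; have [] := C_periodic_continuous n t0 tT. Qed.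
Arguments C_continuous n {t}.

Lemma near_time t : 0 < t -> (t%:E < T)%E ->
  \forall s \near t, 0 <= s /\ (s%:E < T)%E.
Proof.
move=> t0 tT; near=> s; split; last by near: s; exact: near_fin_lt.
by apply: ltW; near: s; exact: lt_nbhsr.
Unshelve. all: by end_near. Qed.

Lemma near_time0 : (0%:E < T)%E ->
  \forall s \near (0 : R)^'+, 0 <= s /\ (s%:E < T)%E.
Proof.
move=> T0; near=> s; split; first by near: s; exact: nbhs_right_ge.
by near: s; apply: cvg_within; exact: near_fin_lt.
Unshelve. all: by end_near. Qed.

Lemma near_C_continuous n t : 0 < t -> (t%:E < T)%E ->
  \forall s \near t, continuous (C n%:Z s).
Proof.
by move=> t0 tT; apply: filterS (near_time t0 tT) => s [s0 sT]; exact: C_continuous.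
Qed.

Lemma C_time_derivative n t : 0 < t -> (t%:E < T)%E ->
  exists2 v, continuous v & time_derivative L (C n%:Z) t v.
Proof.
move=> t0 tT; have [nNH|NHn] := ltnP n NH.
  by have [v [_ cv _] dv] := C_dt sol nNH t0 tT; exists v.
exists (fun=> 0); first exact: cont_cst.
have C0 s x : C n%:Z s x = 0.
  by rewrite C_eq0 // lez_nat.
rewrite /time_derivative (_ : (fun h => _) = fun=> 0); first exact: cvg_cst.
apply/funext => h; under eq_Rintegral do rewrite !C0 !subrr mul0r subrr expr0n /=.
by rewrite (Rintegral_itv_cst L_gt0) mul0r.
Qed.

Lemma C_right_continuous0 n : time_right_continuous0 L (C n%:Z).
Proof.
have [nNH|NHn] := ltnP n NH; first exact: (C_init sol).
have C0 s x : C n%:Z s x = 0.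
  by rewrite C_eq0 // lez_nat.
rewrite /time_right_continuous0 (_ : (fun h => _) = fun=> 0).
  exact: cvg_cst.
apply/funext => h; under eq_Rintegral do rewrite !C0 subrr expr0n /=.
by rewrite (Rintegral_itv_cst L_gt0) mul0r.
Qed.

Lemma C_pairing_is_derive n t f : 0 < t -> (t%:E < T)%E -> continuous f ->
  is_derive t 1 (fun s => \int[mu]_(x in `[0, L]) (C n%:Z s x * f x))
    (derive1 (fun s => \int[mu]_(x in `[0, L]) (C n%:Z s x * f x)) t).
Proof.
move=> t0 tT cf; have [v cv dv] := C_time_derivative n t0 tT.
have := pairing_is_derive (near_C_continuous n t0 tT) cv cf dv.
by rewrite derive1E; case=> h _; exact: DeriveDef.
Qed.

Lemma weak_derivative_cst (c : R) :
  inV L (fun=> c) /\ weak_derivative L (fun=> c) (fun=> 0).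
Proof.
have dc x : is_derive x 1 (cst c : R -> R) 0 by exact: is_derive_cst.
by split; [apply: is_derive_inV dc _|apply: is_derive_weak_derivative dc];
  do ?exact: cont_cst.
Qed.

Lemma E_mean0 t : 0 <= t -> (t%:E < T)%E ->
  \int[mu]_(x in `[0, L]) (E t x) = 0.
Proof.
move=> t0 tT; have [V1 W1] := weak_derivative_cst 1.
have := potential_weak sol t0 tT V1 W1.
under eq_Rintegral do rewrite mulr0.
under [X in _ = X]eq_Rintegral do rewrite mulr1.
by rewrite (Rintegral_itv_cst L_gt0) mul0r.
Qed.

Lemma E_is_derive t : 0 <= t -> (t%:E < T)%E ->
  forall x, is_derive x 1 (E t) (C 0 t x - rho0).
Proof.
move=> t0 tT; have [pE cE _] := E_inV sol t0 tT.
have [cC pC] := C_periodic_continuous 0 t0 tT.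
apply: (weak_is_derive L_gt0) => //.
- by cts.
- by move=> x; rewrite pC.
- exact: (quasi_neutrality sol).
- by move=> z dz; exact: (poisson_weak sol).
Qed.

Lemma E_dist s t : 0 <= s -> (s%:E < T)%E -> 0 <= t -> (t%:E < T)%E ->
  forall x, 0 <= x <= L -> (E s x - E t x) ^+ 2 <=
    L * \int[mu]_(x in `[0, L]) ((C 0 s x - C 0 t x) ^+ 2).
Proof.
move=> s0 sT t0 tT.
have cs := C_continuous 0 s0 sT; have ct := C_continuous 0 t0 tT.
have [_ cEs _] := E_inV sol s0 sT; have [_ cEt _] := E_inV sol t0 tT.
have dE x : is_derive x 1 (E s - E t) (C 0 s x - C 0 t x).
  rewrite (_ : _ - _ = (C 0 s x - rho0) - (C 0 t x - rho0)); last by ring.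
  by apply: is_deriveB; exact: E_is_derive.
apply: (mean0_sup_bound L_gt0 _ dE); first by cts.
by rewrite Rintegral_contB // !E_mean0 // subrr.
Qed.

Lemma supnorm_E_dist s t : 0 <= s -> (s%:E < T)%E -> 0 <= t -> (t%:E < T)%E ->
  (supnorm L (E s) - supnorm L (E t)) ^+ 2 <=
    L * \int[mu]_(x in `[0, L]) ((C 0 s x - C 0 t x) ^+ 2).
Proof.
move=> s0 sT t0 tT.
have [_ cEs _] := E_inV sol s0 sT; have [_ cEt _] := E_inV sol t0 tT.
by apply: supnorm_dist => //; exact: E_dist.
Qed.

Lemma E_L2_dist s t : 0 <= s -> (s%:E < T)%E -> 0 <= t -> (t%:E < T)%E ->
  \int[mu]_(x in `[0, L]) ((E s x - E t x) ^+ 2) <=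
    L ^+ 2 * \int[mu]_(x in `[0, L]) ((C 0 s x - C 0 t x) ^+ 2).
Proof.
move=> s0 sT t0 tT.
have [_ cEs _] := E_inV sol s0 sT; have [_ cEt _] := E_inV sol t0 tT.
rewrite expr2 -mulrA mulrC -(Rintegral_itv_cst L_gt0).
apply: le_Rintegral_cont; cts; exact: E_dist.
Qed.

Lemma supnorm_E_continuous t : 0 < t -> (t%:E < T)%E ->
  {for t, continuous (fun s => supnorm L (E s) ^+ 2)}.
Proof.
move=> t0 tT; have [v cv dv] := C_time_derivative 0 t0 tT.
pose F s := (supnorm L (E s) - supnorm L (E t)) ^+ 2.
have Ft : F t = 0 by rewrite /F subrr expr0n.
have dF : is_derive t 1 F 0.
  apply: (is_derive_square_increment (near_C_continuous 0 t0 tT) cv dv Ft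
    (K := L)).
  apply: filterS (near_time t0 tT) => s [s0 sT].
  by rewrite sqr_ge0 supnorm_E_dist // ltW.
have cF : {for t, continuous F}.
  by apply/differentiable_continuous/derivable1_diffP; have [] := dF.
have F0 : F s @[s --> t] --> 0 by rewrite -Ft; exact: cF.
have NS : supnorm L (E s) @[s --> t] --> supnorm L (E t).
  by apply: (sqr_cvg (Y := F)) => //; near=> s; exact: lexx.
exact: (cvgM NS NS).
Unshelve. all: by end_near. Qed.

Lemma supnorm_E_right_continuous0 : (0%:E < T)%E ->
  supnorm L (E h) ^+ 2 @[h --> 0^'+] --> supnorm L (E 0) ^+ 2.
Proof.
move=> T0; have DC := C_right_continuous0 0.
have NS : supnorm L (E s) @[s --> 0^'+] --> supnorm L (E 0).
  apply: (sqr_cvg (Y := fun s =>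
    L * \int[mu]_(x in `[0, L]) ((C 0 s x - C 0 0 x) ^+ 2))).
    apply: filterS (near_time0 T0) => s [s0 sT].
    by rewrite supnorm_E_dist.
  by rewrite -[X in _ --> X](mulr0 L); apply: cvgM; [exact: cvg_cst|exact: DC].
exact: (cvgM NS NS).
Qed.

Let a_gt0 t : 0 < a t. Proof. exact: alpha_gt0. Qed.

Let a_is_derive t : 0 < t -> (t%:E < T)%E -> is_derive t 1 a (derive1 a t).
Proof.
move=> t0 tT; apply: (alpha_is_derive _ gamma_gt0 _ _ t0 tT).
  exact: supnorm_E_continuous.
by apply: supnorm_E_right_continuous0; apply: lt_trans tT; rewrite lte_fin.
Qed.

Let a_cvg0 : (0%:E < T)%E -> a h @[h --> 0^'+] --> a 0.
Proof.
by move=> T0; apply: (alpha_cvg0 _ _ T0);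
  [exact: supnorm_E_continuous|exact: supnorm_E_right_continuous0].
Qed.

Lemma E_C0_orthogonal t : 0 <= t -> (t%:E < T)%E ->
  \int[mu]_(x in `[0, L]) (E t x * C 0 t x) = 0.
Proof.
move=> t0 tT; have [pE cE _] := E_inV sol t0 tT.
have cC := C_continuous 0 t0 tT; have dE := E_is_derive t0 tT.
have cg : continuous (fun x => C 0 t x - rho0) by cts.
have := Rintegral_by_parts L_gt0 cg cg dE dE.
have -> : E t L = E t 0 by rewrite -[in LHS](add0r L) pE.
under [X in _ + X]eq_Rintegral do rewrite mulrC.
have -> : \int[mu]_(x in `[0, L]) (E t x * (C 0 t x - rho0)) =
    \int[mu]_(x in `[0, L]) (E t x * C 0 t x).
  under eq_Rintegral do rewrite mulrBr [X in _ - X]mulrC.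
  by rewrite Rintegral_contB ?Rintegral_contZ ?E_mean0 ?mulr0 ?subr0 //; cts.
lra.
Qed.

Lemma mass_eq t : 0 <= t -> (t%:E < T)%E -> P 0 t = rho0 * L.
Proof.
move=> t0 tT; have := quasi_neutrality sol t0 tT.
have cC := C_continuous 0 t0 tT.
by rewrite Rintegral_contB ?(Rintegral_itv_cst L_gt0); cts; lra.
Qed.

Lemma P_is_derive n t : 0 < t -> (t%:E < T)%E ->
  is_derive t 1 (P n%:Z) (derive1 (P n%:Z) t).
Proof.
move=> t0 tT; have := C_pairing_is_derive n t0 tT (@cont_cst _ 1).
rewrite (_ : (fun s => _) = P n%:Z) //.
by apply/funext => s; under eq_Rintegral do rewrite mulr1.
Qed.

Lemma momentum_balance t : (2 <= NH)%N -> 0 < t -> (t%:E < T)%E ->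
  derive1 (P 1) t = derive1 a t / a t * P 1 t.
Proof.
move=> NH2 t0 tT; have [V1 W1] := weak_derivative_cst 1.
have := vlasov_weak sol NH2 t0 tT V1 W1; rewrite /=.
have -> : (fun s => \int[mu]_(x in `[0, L]) (C 1 s x * 1)) = P 1.
  by apply/funext => s; under eq_Rintegral do rewrite mulr1.
under [X in _ - _ * X - _ - _ = _]eq_Rintegral do
  rewrite subrr mul0r sqrtr0 mul0r addr0 mul1r mulr1.
under [X in _ - _ - _ * X - _ = _]eq_Rintegral do rewrite mulr0.
under [X in _ - _ - _ * X = _]eq_Rintegral do rewrite mulr1 subrr.
rewrite E_C0_orthogonal ?(ltW t0)// (Rintegral_itv_cst L_gt0) mul0r !mulr0 !subr0.
by move/eqP; rewrite subr_eq0 => /eqP.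
Qed.

Lemma moment_is_derive k t : (k <= 1)%N -> 0 < t -> (t%:E < T)%E ->
  is_derive t 1 (moment L alpha0 gamma C E k) 0.
Proof.
move=> k1 t0 tT; have [k0|] := posnP k.
  subst k; have dc := is_derive_cst (rho0 * L) t 1.
  apply: near_eq_is_derive dc.
  apply: filterS (near_time t0 tT) => s [s0 sT].
  rewrite /moment -(mass_eq s0 sT).
  by apply: eq_Rintegral => x _; rewrite expr0 divr1.
move=> k_gt0; have {k1 k_gt0}-> : k = 1%N by apply/eqP; rewrite eqn_leq k1.
have [NH2|NH1] := leqP 2 NH; last first.
  have dc := is_derive_cst (0 : R) t 1.
  apply: near_eq_is_derive dc; near=> s.
  rewrite /moment C_eq0 ?lez_nat//.
  by under eq_Rintegral do rewrite mul0r; rewrite (Rintegral_itv_cst L_gt0) mul0r.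
have dP := P_is_derive 1 t0 tT.
have aN : a t != 0 by rewrite gt_eqF.
have dV := is_deriveV aN (a_is_derive t0 tT).
have dM := is_deriveM dP dV.
have dE : (P 1 t *: (- a t ^- 2 *: derive1 a t) + (a t)^-1 *: derive1 (P 1) t) = 0.
  by rewrite (momentum_balance NH2 t0 tT) /GRing.scale /=; field.
rewrite dE in dM.
apply: near_eq_is_derive dM.
apply: filterS (near_time t0 tT) => s [s0 sT].
have cC := C_continuous 1 s0 sT.
rewrite /moment expr1 -[LHS]mulrC -Rintegral_contZ //.
by apply: eq_Rintegral => x _; rewrite mulrC.
Unshelve. all: by end_near. Qed.

Lemma second_moment_balance t : (3 <= NH)%N -> 0 < t -> (t%:E < T)%E ->
  derive1 (P 2) t = derive1 a t / a t * (2 * P 2 t + Num.sqrt 2 * P 0 t)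
  + a t * Num.sqrt 2 * \int[mu]_(x in `[0, L]) (E t x * C 1 t x).
Proof.
move=> NH3 t0 tT; have [V1 W1] := weak_derivative_cst 1.
have cC2 := C_continuous 2 (ltW t0) tT.
have cC0 := C_continuous 0 (ltW t0) tT.
have := vlasov_weak sol NH3 t0 tT V1 W1; rewrite /=.
have -> : (fun s => \int[mu]_(x in `[0, L]) (C 2 s x * 1)) = P 2.
  by apply/funext => s; under eq_Rintegral do rewrite mulr1.
have -> : (2%:R - 1) * 2%:R = 2 :> R by ring.
under [X in _ - _ * X - _ - _ = _]eq_Rintegral do rewrite subrr mulr1.
under [X in _ - _ - _ * X - _ = _]eq_Rintegral do rewrite mulr0.
under [X in _ - _ - _ * X = _]eq_Rintegral do rewrite mulr1.
rewrite Rintegral_cont_lin // (Rintegral_itv_cst L_gt0) mul0r mulr0 subr0; lra.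
Qed.

(* The test function is a potential: a periodic antiderivative of [- E t]. *)
Lemma energy_test_function t : 0 <= t -> (t%:E < T)%E ->
  exists psi, [/\ inV L psi, weak_derivative L psi (fun x => - E t x) &
    forall s, 0 <= s -> (s%:E < T)%E ->
    Q s = 2 * (\int[mu]_(x in `[0, L]) (C 0 s x * psi x)
               - rho0 * \int[mu]_(x in `[0, L]) psi x)
          - Q t + \int[mu]_(x in `[0, L]) ((E s x - E t x) ^+ 2)].
Proof.
move=> t0 tT; have [pE cE _] := E_inV sol t0 tT.
have cNE : continuous (fun x => - E t x) by cts.
have [psi dpsi] := antiderivative cNE.
have cpsi := is_derive1_continuous dpsi.
have ppsi : forall x, psi (x + L) = psi x.
  apply: (periodic_is_derive (ltW L_gt0) cNE dpsi) => [x|]; first by rewrite pE.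
  under eq_Rintegral do rewrite -mulN1r.
  by rewrite Rintegral_contZ // E_mean0 // mulr0.
exists psi; split.
- exact: is_derive_inV dpsi ppsi.
- exact: is_derive_weak_derivative.
move=> s s0 sT; have [pEs cEs _] := E_inV sol s0 sT.
have cC := C_continuous 0 s0 sT.
have dEs := E_is_derive s0 sT.
have cg : continuous (fun x => C 0 s x - rho0) by cts.
have := Rintegral_by_parts L_gt0 cg cNE dEs dpsi.
have -> : E s L = E s 0 by rewrite -[in LHS](add0r L) pEs.
have -> : psi L = psi 0 by rewrite -[in LHS](add0r L) ppsi.
have -> : \int[mu]_(x in `[0, L]) (E s x * - E t x) =
    - \int[mu]_(x in `[0, L]) (E s x * E t x).
  rewrite -mulN1r -Rintegral_contZ; cts.
  by apply: eq_Rintegral => x _; ring.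
have -> : \int[mu]_(x in `[0, L]) ((C 0 s x - rho0) * psi x) =
    \int[mu]_(x in `[0, L]) (C 0 s x * psi x)
    - rho0 * \int[mu]_(x in `[0, L]) psi x.
  rewrite -Rintegral_contZ -?Rintegral_contB; cts.
  by apply: eq_Rintegral => x _; ring.
have -> : \int[mu]_(x in `[0, L]) ((E s x - E t x) ^+ 2) =
    Q s - 2 * \int[mu]_(x in `[0, L]) (E s x * E t x) + Q t.
  rewrite -Rintegral_contZ -?Rintegral_contB -?Rintegral_contD; cts.
  by apply: eq_Rintegral => x _; ring.
lra.
Qed.

Lemma Q_is_derive t : (3 <= NH)%N -> 0 < t -> (t%:E < T)%E ->
  is_derive t 1 Q (- 2 * (a t)^-1 * \int[mu]_(x in `[0, L]) (E t x * C 1 t x)).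
Proof.
move=> NH3 t0 tT; have NH0 : (0 < NH)%N by exact: leq_trans NH3.
have [psi [Vpsi Wpsi QE]] := energy_test_function (ltW t0) tT.
have [_ cpsi _] := Vpsi; have [_ cE _] := E_inV sol (ltW t0) tT.
have cC1 := C_continuous 1 (ltW t0) tT.
have [v cv dv] := C_time_derivative 0 t0 tT.
have dD : is_derive t 1 (fun s => \int[mu]_(x in `[0, L]) ((E s x - E t x) ^+ 2)) 0.
  apply: (is_derive_square_increment (near_C_continuous 0 t0 tT) cv dv
    (K := L ^+ 2)).
    under eq_Rintegral do rewrite subrr expr0n /=.
    by rewrite (Rintegral_itv_cst L_gt0) mul0r.
  apply: filterS (near_time t0 tT) => s [s0 sT].
  by rewrite Rintegral_sqr_ge0 E_L2_dist // ltW.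
pose F s := \int[mu]_(x in `[0, L]) (C 0 s x * psi x).
have dF : is_derive t 1 F (derive1 F t) by exact: C_pairing_is_derive.
have FE : derive1 F t = - ((a t)^-1 * \int[mu]_(x in `[0, L]) (E t x * C 1 t x)).
  have := vlasov_weak sol NH0 t0 tT Vpsi Wpsi; rewrite /= -/F.
  under [X in _ - _ * X - _ - _ = _]eq_Rintegral do
    rewrite mulr0 sqrtr0 !mul0r addr0 mul0r.
  under [X in _ - _ - _ * X - _ = _]eq_Rintegral do
    rewrite sqrtr0 mul0r add0r add0r sqrtr1 mul1r mulrN mulrC -mulN1r.
  rewrite sqrtr0 mulr0 mul0r subr0 (Rintegral_itv_cst L_gt0) mul0r mulr0 subr0.
  by rewrite Rintegral_contZ; cts; lra.
pose m := \int[mu]_(x in `[0, L]) psi x.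
have dFm := is_deriveZ 2 (is_deriveB dF (is_derive_cst (rho0 * m) t 1)).
have := is_deriveD (is_deriveD dFm (is_derive_cst (- Q t) t 1)) dD.
rewrite FE (_ : _ + _ + _ =
  - 2 * (a t)^-1 * \int[mu]_(x in `[0, L]) (E t x * C 1 t x)); last first.
  by rewrite /GRing.scale /=; ring.
apply: near_eq_is_derive.
by apply: filterS (near_time t0 tT) => s [s0 sT]; rewrite (QE s s0 sT).
Qed.

Lemma Q_cvg0 : (0%:E < T)%E -> Q h @[h --> 0^'+] --> Q 0.
Proof.
move=> T0; have [psi [[_ cpsi _] _ QE]] := energy_test_function (lexx 0) T0.
have D0 : \int[mu]_(x in `[0, L]) ((E h x - E 0 x) ^+ 2) @[h --> 0^'+] --> 0.
  apply: (@squeeze_cvgr _ _ _ _ (cst 0) (fun h =>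
    L ^+ 2 * \int[mu]_(x in `[0, L]) ((C 0 h x - C 0 0 x) ^+ 2))).
  - apply: filterS (near_time0 T0) => s [s0 sT].
    by rewrite Rintegral_sqr_ge0 E_L2_dist.
  - exact: cvg_cst.
  - rewrite -[X in _ --> X](mulr0 (L ^+ 2)); apply: cvgM; first exact: cvg_cst.
    exact: C_right_continuous0.
have F0 : \int[mu]_(x in `[0, L]) (C 0 h x * psi x) @[h --> 0^'+] -->
    \int[mu]_(x in `[0, L]) (C 0 0 x * psi x).
  apply: right_continuous_pairing => //; last exact: C_right_continuous0.
    by apply: filterS (near_time0 T0) => s [s0 sT]; exact: (C_continuous 0).
  exact: (C_continuous 0).
pose m := \int[mu]_(x in `[0, L]) psi x.
have lim : 2 * (\int[mu]_(x in `[0, L]) (C 0 h x * psi x) - rho0 * m) - Q 0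
    + \int[mu]_(x in `[0, L]) ((E h x - E 0 x) ^+ 2) @[h --> 0^'+] -->
  2 * (\int[mu]_(x in `[0, L]) (C 0 0 x * psi x) - rho0 * m) - Q 0 + 0.
  apply: cvgD => //; apply: cvgB; last exact: cvg_cst.
  apply: cvgM; first exact: cvg_cst.
  by apply: cvgB => //; exact: cvg_cst.
have Q0 := QE 0 (lexx 0) T0.
have E00 : \int[mu]_(x in `[0, L]) ((E 0 x - E 0 x) ^+ 2) = 0.
  under eq_Rintegral do rewrite subrr expr0n /=.
  by rewrite (Rintegral_itv_cst L_gt0) mul0r.
rewrite E00 in Q0; rewrite [X in _ --> X]Q0.
apply: cvg_trans lim; apply: near_eq_cvg.
by apply: filterS (near_time0 T0) => s [s0 sT]; rewrite (QE s s0 sT).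
Qed.

Lemma P_cvg0 n : (0%:E < T)%E -> P n%:Z h @[h --> 0^'+] --> P n%:Z 0.
Proof.
move=> T0.
have PE : P n%:Z = fun s => \int[mu]_(x in `[0, L]) (C n%:Z s x * 1).
  by apply/funext => s; under [RHS]eq_Rintegral do rewrite mulr1.
have : \int[mu]_(x in `[0, L]) (C n%:Z h x * 1) @[h --> 0^'+] -->
    \int[mu]_(x in `[0, L]) (C n%:Z 0 x * 1).
  apply: right_continuous_pairing; last exact: C_right_continuous0.
  - by apply: filterS (near_time0 T0) => s [s0 sT]; exact: C_continuous.
  - exact: C_continuous.
  - exact: cont_cst.
under [X in _ --> X]eq_Rintegral do rewrite mulr1.
by rewrite -PE.
Qed.

Let energy_expr s :=
  2^-1 * ((a s ^+ 2)^-1 * (Num.sqrt 2 * P 2 s + P 0 s) + Q s).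

Lemma energyE t : 0 <= t -> (t%:E < T)%E ->
  energy L alpha0 gamma C E t = energy_expr t.
Proof.
move=> t0 tT; have cC2 := C_continuous 2 t0 tT; have cC0 := C_continuous 0 t0 tT.
have [_ cE _] := E_inV sol t0 tT; rewrite /energy /energy_expr.
congr (_ * _); rewrite -Rintegral_contZ -?Rintegral_contD
  -?Rintegral_contZ -?Rintegral_contD; cts.
by apply: eq_Rintegral => x _; rewrite real_normK ?num_real.
Qed.

Lemma energy_balance_algebra (x da p2 p0 q : R) : x != 0 ->
  2^-1 * ((x ^+ 2)^-1 * (Num.sqrt 2 * (da / x * (2 * p2 + Num.sqrt 2 * p0)
                                       + x * Num.sqrt 2 * q) + 0)
          + (Num.sqrt 2 * p2 + p0) * (- (x ^+ 2) ^- 2 * (2 * x ^+ 1 * da))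
          + - 2 / x * q) = 0.
Proof.
move=> x0; have : Num.sqrt 2 ^+ 2 = 2 :> R by rewrite sqr_sqrtr.
set s := Num.sqrt 2 => s2.
transitivity (2^-1 * (da * p0 / x ^+ 3 + q / x) * (s ^+ 2 - 2)); first by field.
by rewrite s2 subrr mulr0.
Qed.

Lemma energy_is_derive t : (3 <= NH)%N -> 0 < t -> (t%:E < T)%E ->
  is_derive t 1 (energy L alpha0 gamma C E) 0.
Proof.
move=> NH3 t0 tT.
have aN : a t != 0 by rewrite gt_eqF.
have a2N : (a ^+ 2) t != 0 by exact: (mulf_neq0 aN aN).
have dV := is_deriveV a2N (is_deriveX 2 (a_is_derive t0 tT)).
have dP2 := is_deriveZ (Num.sqrt 2) (P_is_derive 2 t0 tT).
have dP := is_deriveD dP2 (P_is_derive 0 t0 tT).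
have dQ := Q_is_derive NH3 t0 tT.
have dE := is_deriveZ 2^-1 (is_deriveD (is_deriveM dV dP) dQ).
have P0' : derive1 (P 0) t = 0.
  rewrite derive1E; apply: derive_val.
  apply: near_eq_is_derive (is_derive_cst (rho0 * L) t 1).
  by apply: filterS (near_time t0 tT) => s [s0 sT]; rewrite (mass_eq s0 sT).
move: dE; set d := 2^-1 *: _; have -> : d = 0.
  rewrite /d (second_moment_balance NH3 t0 tT) P0' /GRing.scale /=.
  exact: energy_balance_algebra.
move=> dE; have {}dE : is_derive t 1 energy_expr 0 by exact: dE.
apply: (near_eq_is_derive _ dE).
apply: filterS (near_time t0 tT) => s [s0 sT]; exact/esym/energyE.
Qed.

Lemma energy_cvg0 : (0%:E < T)%E ->
  energy L alpha0 gamma C E h @[h --> 0^'+] --> energy L alpha0 gamma C E 0.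
Proof.
move=> T0; rewrite energyE //.
have lim : energy_expr h @[h --> 0^'+] --> energy_expr 0.
  apply: cvgM; first exact: cvg_cst.
  apply: cvgD; last exact: Q_cvg0.
  apply: cvgM.
    apply: cvgV; first by rewrite expf_eq0 /= gt_eqF.
    by apply: (cvgM (a_cvg0 T0) (a_cvg0 T0)).
  by apply: cvgD; [apply: cvgM; [exact: cvg_cst|]|]; exact: P_cvg0.
apply: cvg_trans lim; apply: near_eq_cvg.
by apply: filterS (near_time0 T0) => s [s0 sT]; rewrite energyE.
Qed.

Lemma energy_conserved t : NH != 1%N -> NH != 2%N -> 0 <= t -> (t%:E < T)%E ->
  energy L alpha0 gamma C E t = energy L alpha0 gamma C E 0.
Proof.
move=> NH1 NH2; rewrite le_eqVlt => /predU1P[<- //|t0] tT.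
have T0 : (0%:E < T)%E by apply: lt_trans tT; rewrite lte_fin.
have [NH0|NH_gt0] := posnP NH.
  rewrite /energy; congr (_ * _); apply: eq_Rintegral => x xL.
  have C0 (n : nat) s y : C n%:Z s y = 0.
    by rewrite C_eq0 // NH0.
  have drop (k c2 c0 e : R) : c2 = 0 -> c0 = 0 ->
      k * (Num.sqrt 2 * c2 + c0) + e = e.
    by move=> -> ->; rewrite mulr0 addr0 mulr0 add0r.
  rewrite [LHS](drop _ _ _ _ (C0 2 t x) (C0 0 t x)).
  rewrite [RHS](drop _ _ _ _ (C0 2 0 x) (C0 0 0 x)).
  suff -> : E t x = E 0 x by [].
  move: xL; rewrite inE /= in_itv /= => xL.
  have := E_dist (ltW t0) tT (lexx 0) T0 xL.
  have -> : \int[mu]_(y in `[0, L]) ((C 0 t y - C 0 0 y) ^+ 2) = 0.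
    transitivity (\int[mu]_(y in `[0, L]) (0 : R)).
      2: by rewrite (Rintegral_itv_cst L_gt0) mul0r.
    apply: eq_Rintegral => y _.
    by rewrite (C0 0 t y) (C0 0 0 y) subrr expr0n.
  rewrite mulr0 => h.
  by apply/eqP; rewrite -subr_eq0 -sqrf_eq0 eq_le h sqr_ge0.
have NH3 : (3 <= NH)%N by case: NH NH1 NH2 NH_gt0 => [|[|[|]]].
have sT s : s <= t -> (s%:E < T)%E.
  by move=> st; apply: le_lt_trans tT; rewrite lee_fin.
have de s : 0 < s -> s <= t -> is_derive s 1 (energy L alpha0 gamma C E) 0.
  by move=> s0 st; apply: energy_is_derive => //; exact: sT.
have ce s : 0 < s -> s <= t -> {for s, continuous (energy L alpha0 gamma C E)}.
  move=> s0 st; apply/differentiable_continuous/derivable1_diffP.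
  by have [] := de s s0 st.
have := @MVT R (energy L alpha0 gamma C E) (fun=> 0) 0 t t0.
case.
- by move=> s; rewrite in_itv /= => /andP[s0 /ltW st]; exact: de.
- apply/continuous_within_itvP => //; split.
  + by move=> s; rewrite in_itv /= => /andP[s0 /ltW st]; exact: ce.
  + exact: energy_cvg0.
  + by apply: cvg_at_left_filter; exact: ce.
- by move=> c _; rewrite mul0r => /eqP; rewrite subr_eq0 => /eqP.
Qed.

End solution.

Theorem proposition2p1 (R : realType) (L alpha0 gamma rho0 : R)
    (L_gt0 : 0 < L) (alpha0_gt0 : 0 < alpha0) (gamma_gt0 : 0 < gamma)
    (NH : nat) (T : \bar R)
    (C : int -> R -> R -> R) (Phi E : R -> R -> R)
    (sol : hermite_solution L alpha0 gamma rho0 NH T C Phi E)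
    (f : R -> R -> R -> R)
    (f_def : forall t x v, f t x v = truncated_series L alpha0 gamma NH C E t x v) :
  (forall k : nat, (k <= 1)%N ->
     forall t : R, 0 < t -> (t%:E < T)%E ->
       is_derive t 1 (moment L alpha0 gamma C E k) 0) /\
  (NH != 1%N -> NH != 2%N ->
     forall t : R, 0 <= t -> (t%:E < T)%E ->
       energy L alpha0 gamma C E t = energy L alpha0 gamma C E 0).
Proof.
split.
  by move=> k k1 t t0 tT; apply: (moment_is_derive _ _ _ sol).
by move=> NH1 NH2 t t0 tT; apply: (energy_conserved _ _ _ sol).
Qed.
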